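(* Let $S$ be a semigroup, $L$ an $\mathscr L$-class of $S$, and $H$ an $\mathscr H$-class contained in $L$. The mapping \[ \phi:[\Delta_{\overline{L}},\mathscr H_{\overline{L}}]\rightarrow \mathrm{LCong}(H,\star);\quad \sigma\mapsto\sigma{\restriction}_{H} \] is a lattice isomorphism, where $[\Delta_{\overline{L}},\mathscr H_{\overline{L}}]$ is the interval in the lattice $\mathrm{Cong}({}^S\overline L)$. Consequently, the interval $[\Delta_{\overline{L}},\mathscr H_{\overline{L}}]$ is isomorphic to the subgroup lattice $\mathrm{Sub}(\Gamma(H))$ of the Schützenberger group $\Gamma(H)$ of $H$.
   Context: For a semigroup $S$, $S^1$ is $S$ if $S$ is a monoid and otherwise $S$ with an identity adjoined. Green's relations: $x\mathrel{\mathscr L}y\Leftrightarrow S^1x=S^1y$, $x\mathrel{\mathscr R}y\Leftrightarrow xS^1=yS^1$, $\mathscr H=\mathscr L\cap\mathscr R$. A left $S$-act is a set $A$ with maps $a\mapsto s\cdot a$ ($s\in S$) satisfying $s\cdot(s'\cdot a)=(ss')\cdot a$; a congruence of $A$ is an equivalence relation $\sigma$ on $A$ such that $(a,b)\in\sigma$ implies $(s\cdot a,s\cdot b)\in\sigma$ for all $s\in S$; $\mathrm{Cong}(A)$ is the lattice of congruences. For an $\mathscr L$-class $L$, ${}^S\overline L$ is the left $S$-act with underlying set $\overline L=L\cup\{0\}$ ($0\notin S$ a new symbol) and action $s\cdot x=sx$ if $x,sx\in L$, and $s\cdot x=0$ otherwise. $\Delta_{\overline L}$ is the equality relation on $\overline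 L$, and $\mathscr H_{\overline L}=\mathscr H{\restriction}_L\cup\{(0,0)\}$, which is a congruence of ${}^S\overline L$. For an $\mathscr H$-class $H$, let $T_R=\{t\in S^1: Ht\subseteq H\}$ and for $t\in T_R$ let $\rho_t:H\to H$, $x\mapsto xt$. The (right) Schützenberger group is $\Gamma(H)=\Gamma_R(H)=\{\rho_t:t\in T_R\}$, a group under composition (maps acting on the right), acting simply transitively on $H$. Fix an arbitrary $h_0\in H$. For $h_1,h_2\in H$ let $\alpha_1,\alpha_2$ be the unique elements of $\Gamma_R(H)$ with $h_i=h_0\alpha_i$, and put $h_1\star h_2=h_0\alpha_1\alpha_2$. Then $(H,\star)$ is a group with identity $h_0$, isomorphic to $\Gamma(H)$. $\mathrm{LCong}(H,\star)$ is the lattice of left congruences of this group, i.e. equivalence relations $\tau$ on $H$ such that $(x,y)\in\tau$ implies $(a\star x,a\star y)\in\tau$ for all $a\in H$. *)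

(* Defs.v *)
From HB Require Import structures.
From mathcomp Require Import all_boot all_order.
From mathcomp Require Import boolp classical_sets.

Set Implicit Arguments.
Unset Strict Implicit.
Unset Printing Implicit Defensive.

Import Order.Theory.
Local Open Scope classical_set_scope.

Record closure_system (T : Type) := ClosureSystem {
  is_closed : set (set T);
  closed_bigcap : forall F : set (set T),
    F `<=` is_closed -> is_closed (\bigcap_(A in F) A)
}.

(* The lattice of closed sets, ordered by inclusion: the meet is the
   intersection, the join is the least closed set containing both sets. *)
Record closed_set (T : Type) (C : closure_system T) := ClosedSet {
  set_of_closed :> set T;
  closedP : set_of_closed \in is_closed C
}.

Section ClosedSets.
Variables (T : Type) (C : closure_system T).
Implicit Types X Y Z : closed_set C.

HB.instance Definition _ := [isSub for @set_of_closed T C].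
HB.instance Definition _ := [Choice of closed_set C by <:].
HB.instance Definition _ :=
  [SubChoice_isSubPOrder of closed_set C by <: with set_display].

Lemma closed_setP X : is_closed C X.
Proof. by apply/set_mem; exact: closedP. Qed.

Lemma closed_set_leP X Y : reflect (X `<=` Y) (X <= Y)%O.
Proof. by rewrite -Order.le_val; exact: subsetPset. Qed.

Lemma closed_meet_subproof X Y : (X `&` Y : set T) \in is_closed C.
Proof.
apply/mem_set; rewrite -(bigcap2E (X : set T)).
have -> : \bigcap_i bigcap2 (X : set T) Y i =
          \bigcap_(A in [set set_of_closed X; set_of_closed Y]) A.
  rewrite bigcap2E; apply/seteqP; split=> [x [xX xY] A [] -> //|x xF].
  by split; apply: xF; [left|right].
by apply: closed_bigcap => A [] ->; exact: closed_setP.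
Qed.

Definition closed_meet X Y : closed_set C :=
  ClosedSet (closed_meet_subproof X Y).

Lemma closed_join_subproof X Y :
  \bigcap_(A in [set A | is_closed C A /\ X `|` Y `<=` A]) A \in is_closed C.
Proof. by apply/mem_set; apply: closed_bigcap => A []. Qed.

Definition closed_join X Y : closed_set C :=
  ClosedSet (closed_join_subproof X Y).

Lemma closed_meetP X Y Z :
  (X <= closed_meet Y Z)%O = (X <= Y)%O && (X <= Z)%O.
Proof.
apply/closed_set_leP/andP => [XI|[/closed_set_leP XY /closed_set_leP XZ] x Xx].
  by split; apply/closed_set_leP => x /XI [].
by split; [exact: XY|exact: XZ].
Qed.

Lemma closed_joinP X Y Z :
  (closed_join X Y <= Z)%O = (X <= Z)%O && (Y <= Z)%O.
Proof.
apply/closed_set_leP/andP => [UZ|[/closed_set_leP XZ /closed_set_leP YZ] x].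
  by split; apply/closed_set_leP => x Xx; apply: UZ => A [_]; apply;
    [left|right].
by apply; split; [exact: closed_setP|move=> y [/XZ|/YZ]].
Qed.

HB.instance Definition _ := Order.POrder_MeetJoin_isLattice.Build
  set_display (closed_set C) closed_meetP closed_joinP.

End ClosedSets.

Record lattice_interval d (T : latticeType d) (a b : T) := LatticeInterval {
  interval_val :> T;
  interval_valP : (a <= interval_val <= b)%O
}.

Section LatticeInterval.
Variables (d : Order.disp_t) (T : latticeType d) (a b : T).

HB.instance Definition _ := [isSub for @interval_val d T a b].
HB.instance Definition _ := [Choice of lattice_interval a b by <:].

Let P := [pred x | (a <= x <= b)%O].

Lemma interval_meet_closed : meet_closed P.
Proof.
move=> x y /andP[ax xb] /andP[ay yb]; apply/andP.
by rewrite lexI ax ay leIx2 ?xb.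
Qed.

Lemma interval_join_closed : join_closed P.
Proof.
move=> x y /andP[ax xb] /andP[ay yb]; apply/andP.
by rewrite leUx xb yb lexU2 ?ax.
Qed.

HB.instance Definition _ := Order.SubChoice_isSubLattice.Build
  d T P d (lattice_interval a b) interval_meet_closed interval_join_closed.

End LatticeInterval.

Section SubgroupLattice.
Variable G : groupType.
Local Open Scope group_scope.

Definition is_subgroup : set (set G) := [set A | group_closed [in A]].

Lemma is_subgroup_bigcap (F : set (set G)) :
  F `<=` is_subgroup -> is_subgroup (\bigcap_(A in F) A).
Proof.
move=> FG; split=> [|x y /set_mem xF /set_mem yF]; apply/mem_set => A FA;
  have [A1 AV] := FG A FA; first exact: set_mem.
by apply: set_mem; apply: AV; apply/mem_set; [exact: xF|exact: yF].
Qed.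

Definition Subgroups := closed_set (ClosureSystem is_subgroup_bigcap).

HB.instance Definition _ := Order.Lattice.on Subgroups.

End SubgroupLattice.

Record leftAct (S : semigroupType) := LeftAct {
  act_sort :> Type;
  act : S -> act_sort -> act_sort;
  actA : forall s t a, act s (act t a) = act (s * t)%g a
}.

Section Congruences.
Variables (S : semigroupType) (A : leftAct S).

Definition is_congruence : set (set (A * A)) := [set sigma |
  [/\ forall a, sigma (a, a),
      forall a b, sigma (a, b) -> sigma (b, a),
      forall a b c, sigma (a, b) -> sigma (b, c) -> sigma (a, c)
    & forall s a b, sigma (a, b) -> sigma (act s a, act s b)]].

Lemma is_congruence_bigcap (F : set (set (A * A))) :
  F `<=` is_congruence -> is_congruence (\bigcap_(sigma in F) sigma).
Proof.
move=> FC; split=> [a|a b abF|a b c abF bcF|s a b abF] sigma Fs;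
  have [rs ss ts cs] := FC _ Fs.
- exact: rs.
- by apply: ss; exact: abF.
- by apply: ts (abF _ Fs) (bcF _ Fs).
- by apply: cs; exact: abF.
Qed.

Definition cong_system := ClosureSystem is_congruence_bigcap.

Definition Cong := closed_set cong_system.

HB.instance Definition _ := Order.Lattice.on Cong.

End Congruences.

Definition regular_act (G : semigroupType) : leftAct G :=
  @LeftAct G G *%g (@mulgA G).

(* The left congruences of G are the equivalence relations compatible with
   left multiplications. *)
Definition LCong (G : semigroupType) := Cong (regular_act G).

Section Green.
Variable S : semigroupType.
Local Open Scope group_scope.
Implicit Types (x y z s : S) (t u : option S).

Definition has_identity := exists e : S, forall x, e * x = x /\ x * e = x.

(* S^1, as a subset of [option S]: the adjoined identity [None] is a member
   only if S is not already a monoid. *)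
Definition S1 : set (option S) := [set t | t = None -> ~ has_identity].

Definition mulS1l t x := if t is Some s then s * x else x.
Definition mulS1r x t := if t is Some s then x * s else x.

Definition lideal x : set S := [set mulS1l t x | t in S1].
Definition rideal x : set S := [set mulS1r x t | t in S1].

Definition greenL x y := lideal x = lideal y.
Definition greenR x y := rideal x = rideal y.
Definition greenH x y := greenL x y /\ greenR x y.

Lemma lidealP x y : lideal x y <-> exists t, y = mulS1l t x.
Proof.
split=> [[t _ <-]|[[s|] ->]]; first by exists t.
  by exists (Some s).
have [[e eP]|NS] := pselect has_identity; last by exists None.
by exists (Some e) => //=; have [] := eP x.
Qed.

Lemma ridealP x y : rideal x y <-> exists t, y = mulS1r x t.
Proof.
split=> [[t _ <-]|[[s|] ->]]; first by exists t.
  by exists (Some s).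
have [[e eP]|NS] := pselect has_identity; last by exists None.
by exists (Some e) => //=; have [] := eP x.
Qed.

Lemma mulS1lA t u x : exists v, mulS1l t (mulS1l u x) = mulS1l v x.
Proof.
case: t u => [s|] [r|]; [exists (Some (s * r))|exists (Some s)|exists (Some r)
  |exists None] => //=; exact: mulgA.
Qed.

Lemma mulS1rA t u x : exists v, mulS1r (mulS1r x t) u = mulS1r x v.
Proof.
case: t u => [s|] [r|]; [exists (Some (s * r))|exists (Some s)|exists (Some r)
  |exists None] => //=; exact/esym/mulgA.
Qed.

Lemma mulS1lrA t u x : mulS1l t (mulS1r x u) = mulS1r (mulS1l t x) u.
Proof. by case: t u => [s|] [r|] //=; exact: mulgA. Qed.

Lemma greenLP x y :
  greenL x y <-> (exists t, y = mulS1l t x) /\ (exists t, x = mulS1l t y).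
Proof.
split=> [xy|[[t yt] [u xu]]].
  split; apply/lidealP; [rewrite xy|rewrite -xy];
    by apply/lidealP; exists None.
apply/seteqP; split=> z /lidealP [v ->]; apply/lidealP.
  by rewrite xu; exact: mulS1lA.
by rewrite yt; exact: mulS1lA.
Qed.

Lemma greenRP x y :
  greenR x y <-> (exists t, y = mulS1r x t) /\ (exists t, x = mulS1r y t).
Proof.
split=> [xy|[[t yt] [u xu]]].
  split; apply/ridealP; [rewrite xy|rewrite -xy];
    by apply/ridealP; exists None.
apply/seteqP; split=> z /ridealP [v ->]; apply/ridealP.
  by rewrite xu; exact: mulS1rA.
by rewrite yt; exact: mulS1rA.
Qed.

Lemma greenL_mulr t x y : greenL x y -> greenL (mulS1r x t) (mulS1r y t).
Proof.
by move=> /greenLP [[u ->] [v xv]]; apply/greenLP; split;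
  [exists u|exists v; rewrite [in LHS]xv]; rewrite mulS1lrA.
Qed.

Lemma greenR_mull t x y : greenR x y -> greenR (mulS1l t x) (mulS1l t y).
Proof.
by move=> /greenRP [[u ->] [v xv]]; apply/greenRP; split;
  [exists u|exists v; rewrite [in LHS]xv]; rewrite mulS1lrA.
Qed.

Record Lclass := MkLclass {
  Lclass_set :> set S;
  LclassP : exists a, Lclass_set = [set x | greenL a x]
}.

Record Hclass := MkHclass {
  Hclass_set :> set S;
  HclassP : exists a, Hclass_set = [set x | greenH a x]
}.

Lemma Lclass_greenL (L : Lclass) x y :
  Lclass_set L x -> Lclass_set L y <-> greenL x y.
Proof. by case: (LclassP L) => a -> ax; rewrite /= /greenL ax. Qed.

Lemma Hclass_greenH (H : Hclass) x y :
  Hclass_set H x -> Hclass_set H y <-> greenH x y.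
Proof.
by case: (HclassP H) => a -> [axL axR]; rewrite /= /greenH /greenL axL /greenR axR.
Qed.

End Green.

Section Lbar.
Variables (S : semigroupType) (L : Lclass S).
Local Open Scope group_scope.

(* The carrier of the act is [option L], with [None] as zero. [to_Lbar] maps
   the elements of L to themselves and all other elements of S to zero. *)
Definition to_Lbar (x : S) : option L := insub x.

Definition Lbar_act (s : S) (x : option L) : option L :=
  if x is Some y then to_Lbar (s * val y) else None.

Lemma Lbar_actA s t a : Lbar_act s (Lbar_act t a) = Lbar_act (s * t) a.
Proof.
case: a => //= a; rewrite /to_Lbar.
case: insubP => /= [b _ ->|taL]; first by rewrite mulgA.
rewrite insubN //; apply: contra taL => /set_mem staL; apply/mem_set.
have La := set_mem (valP a).
apply/(Lclass_greenL _ La)/greenLP; split; first by exists (Some t).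
have /greenLP [_ [u au]] := (Lclass_greenL _ La).1 staL.
have [v vP] := mulS1lA u (Some s) (t * val a).
by exists v; rewrite -vP /= mulgA.
Qed.

Definition Lbar : leftAct S := LeftAct Lbar_actA.

Definition Delta_set : set (Lbar * Lbar) := [set p | p.1 = p.2].

Definition HL_set : set (Lbar * Lbar) := [set p |
  (exists x y : L, p = (Some x, Some y) /\ greenH (val x) (val y))
  \/ p = (None, None)].

Lemma Delta_subproof : Delta_set \in @is_congruence S Lbar.
Proof.
by apply/mem_set; split=> [a|a b|a b c|s a b]; rewrite /Delta_set /= => // -> //.
Qed.

Lemma HL_subproof : HL_set \in @is_congruence S Lbar.
Proof.
apply/mem_set; split.
- by case=> [a|]; [left; exists a, a|right].
- move=> _ _ [[x [y [[-> ->] [xyL xyR]]]]|[-> ->]]; last by right.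
  by left; exists y, x.
- move=> a b c [[x [y [[-> ->] [xyL xyR]]]]|[-> ->]]; last first.
    by case=> [[x [y []]]|[->]] //; right.
  move=> [[y' [z [[<- ->] [yzL yzR]]]]|[]] //; left; exists x, z.
  by split=> //; split; [exact: etrans yzL|exact: etrans yzR].
- move=> s a b [[x [y [[-> ->] [xyL xyR]]]]|[-> ->]]; last by right.
  rewrite /= /to_Lbar.
  have Lx := set_mem (valP x); have Ly := set_mem (valP y).
  have key x' y' : Lclass_set L x' -> Lclass_set L y' -> greenR x' y' ->
      Lclass_set L (s * x') -> Lclass_set L (s * y').
    move=> Lx' Ly' xyR' /(Lclass_greenL _ Lx') /greenLP [_ [u xu]].
    apply/(Lclass_greenL _ Ly')/greenLP; split; first by exists (Some s).
    have /greenRP [[t yt] _] := xyR'.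
    exists u; rewrite [in LHS]yt [in LHS]xu -mulS1lrA; congr mulS1l.
    by rewrite yt -(mulS1lrA (Some s)).
  case: insubP => [sx /set_mem Lsx vsx|sxL]; case: insubP => [sy|].
  + move=> /set_mem Lsy vsy; left; exists sx, sy; split=> //; rewrite vsx vsy.
    by split; [exact/(Lclass_greenL _ Lsx)|exact: (greenR_mull (Some s))].
  + by rewrite notin_setE => -[]; exact: key Lsx.
  + move=> /set_mem Lsy; move: sxL; rewrite notin_setE => -[].
    by apply: key Lsy => //; exact/esym.
  + by right.
Qed.

Definition Delta_Lbar : Cong Lbar :=
  @ClosedSet _ (cong_system Lbar) _ Delta_subproof.
Definition H_Lbar : Cong Lbar :=
  @ClosedSet _ (cong_system Lbar) _ HL_subproof.

End Lbar.

Section Schutzenberger.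
Variables (S : semigroupType) (H : Hclass S).
Local Open Scope group_scope.

Definition T_R : set (option S) :=
  [set t | S1 t /\ [set mulS1r x t | x in (H : set S)] `<=` H].

Definition is_rho (t : option S) (f : H -> H) :=
  forall x : H, val (f x) = mulS1r (val x) t.

Definition Gamma_set : set (H -> H) := [set f | exists2 t, T_R t & is_rho t f].

Record Gamma := MkGamma {
  Gamma_fun :> H -> H;
  GammaP : Gamma_fun \in Gamma_set
}.

HB.instance Definition _ := [isSub for Gamma_fun].
HB.instance Definition _ := [Choice of Gamma by <:].

Lemma Gamma_ext (f g : Gamma) : f =1 g -> f = g.
Proof. by move=> fg; apply: val_inj; apply/funext. Qed.

Lemma H_greenH (x y : H) : greenH (val x) (val y).
Proof. exact/(Hclass_greenH _ (set_mem (valP x)))/set_mem/(valP y). Qed.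

Lemma mulS1r_stable (t : option S) (h x : S) :
  Hclass_set H h -> Hclass_set H (mulS1r h t) ->
  Hclass_set H x -> Hclass_set H (mulS1r x t).
Proof.
move=> Hh Hht Hx.
have [hhtL hhtR] := (Hclass_greenH _ Hh).1 Hht.
have [hxL hxR] := (Hclass_greenH _ Hh).1 Hx.
apply/(Hclass_greenH _ Hh); split.
  exact: etrans hhtL (greenL_mulr t hxL).
apply: etrans hxR _; have /greenLP [[s xs] _] := hxL.
by rewrite [in RHS]xs -mulS1lrA xs; exact: greenR_mull.
Qed.

Lemma Gamma_of (t : option S) (h : S) :
  Hclass_set H h -> Hclass_set H (mulS1r h t) ->
  exists f : Gamma, is_rho t f.
Proof.
move=> Hh Hht.
have [u Su uP] : exists2 u, S1 u & forall x, mulS1r x u = mulS1r x t.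
  case: t {Hht} => [s|]; first by exists (Some s).
  have [[e eP]|NS] := pselect (has_identity S); last by exists None.
  by exists (Some e) => // x /=; have [] := eP x.
have st x : Hclass_set H x -> Hclass_set H (mulS1r x t)
  by exact: mulS1r_stable Hh Hht.
have fP (x : H) : mulS1r (val x) t \in (H : set S).
  by apply/mem_set/st/set_mem; exact: valP.
pose f (x : H) : H := exist (fun z => z \in (H : set S)) _ (fP x).
have fG : f \in Gamma_set.
  apply/mem_set; exists u => [|x]; last by rewrite uP.
  by split=> // _ [x Hx <-]; rewrite uP; exact: st.
by exists (MkGamma fG).
Qed.

Lemma Gamma_transitive (h x : H) : exists f : Gamma, f h = x.
Proof.
have [_ /greenRP [[t xt] _]] := H_greenH h x.
have [||f fP] := @Gamma_of t (val h).
- exact/set_mem/(valP h).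
- by rewrite -xt; exact/set_mem/(valP x).
by exists f; apply: val_inj; rewrite fP.
Qed.

Lemma Gamma_free (f g : Gamma) (h : H) : f h = g h -> f = g.
Proof.
move=> fg; apply: Gamma_ext => x; apply: val_inj.
have [t _ ft] := set_mem (GammaP f); have [u _ gu] := set_mem (GammaP g).
have [/greenLP [[s xs] _] _] := H_greenH h x.
by rewrite ft gu xs -!mulS1lrA -ft -gu fg.
Qed.

Definition Gamma_choose (h x : H) : {f : Gamma | f h = x} :=
  cid (Gamma_transitive h x).

Lemma Gamma_one_subproof : id \in Gamma_set.
Proof.
case: (HclassP H) => a Ha.
have Haa : Hclass_set H a by rewrite Ha; split.
have [f fP] := Gamma_of (t := None) Haa Haa.
have /set_mem := GammaP f; have -> // : Gamma_fun f = id.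
  by apply/funext => x; apply: val_inj; rewrite fP.
by move=> ?; apply/mem_set.
Qed.

Lemma Gamma_mul_subproof (f g : Gamma) : g \o f \in Gamma_set.
Proof.
have [t _ ft] := set_mem (GammaP f); have [u _ gu] := set_mem (GammaP g).
case: (HclassP H) => a Ha.
have Haa : Hclass_set H a by rewrite Ha; split.
have [v vP] : exists v, forall x, mulS1r (mulS1r x t) u = mulS1r x v.
  case: (t) (u) => [s|] [r|]; [exists (Some (s * r))|exists (Some s)
    |exists (Some r)|exists None] => //= x; exact/esym/mulgA.
pose a' : H := exist (fun z => z \in (H : set S)) a (mem_set Haa).
have Hav : Hclass_set H (mulS1r a v).
  by rewrite -vP -(ft a') -gu; exact/set_mem/(valP (g (f a'))).
have [k kP] := Gamma_of Haa Hav.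
rewrite (_ : g \o f = k) ?GammaP //.
by apply/funext => x; apply: val_inj; rewrite kP /= gu ft.
Qed.

Lemma Gamma_inv_subproof (f : Gamma) : exists g : Gamma, cancel f g.
Proof.
case: (HclassP H) => a Ha.
have Haa : a \in (H : set S) by apply/mem_set; rewrite Ha; split.
pose a' : H := exist (fun z => z \in (H : set S)) a Haa.
have [g ga] := Gamma_transitive (f a') a'.
exists g => x.
by have /(congr1 (fun k : Gamma => k x)) :=
  @Gamma_free (MkGamma (Gamma_mul_subproof f g)) (MkGamma Gamma_one_subproof)
    a' ga.
Qed.

Definition Gamma_one : Gamma := MkGamma Gamma_one_subproof.
(* Maps act on the right: x (f g) = (x f) g. *)
Definition Gamma_mul (f g : Gamma) : Gamma := MkGamma (Gamma_mul_subproof f g).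
Definition Gamma_inv (f : Gamma) : Gamma := projT1 (cid (Gamma_inv_subproof f)).

Lemma Gamma_mulA : associative Gamma_mul.
Proof. by move=> f g h; exact: Gamma_ext. Qed.
Lemma Gamma_mul1g : left_id Gamma_one Gamma_mul.
Proof. by move=> f; exact: Gamma_ext. Qed.
Lemma Gamma_mulg1 : right_id Gamma_one Gamma_mul.
Proof. by move=> f; exact: Gamma_ext. Qed.
Lemma Gamma_mulgV : right_inverse Gamma_one Gamma_inv Gamma_mul.
Proof.
by move=> f; apply: Gamma_ext => x; rewrite /Gamma_inv; case: cid => g /= ->.
Qed.
Lemma Gamma_mulVg : left_inverse Gamma_one Gamma_inv Gamma_mul.
Proof.
move=> f; rewrite -[LHS]Gamma_mulg1 -(Gamma_mulgV (Gamma_inv f)).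
by rewrite Gamma_mulA -(Gamma_mulA _ f) Gamma_mulgV Gamma_mulg1 Gamma_mulgV.
Qed.

HB.instance Definition _ := isGroup.Build Gamma
  Gamma_mulA Gamma_mul1g Gamma_mulg1 Gamma_mulVg Gamma_mulgV.

(* The set H with the group law [star], which depends on the identity h0. *)
Definition star_group (h0 : H) : Type := H.

Section Star.
Variable h0 : H.

HB.instance Definition _ := Choice.copy (star_group h0) (set_type H).

Implicit Types x y z : star_group h0.

Definition Gamma_at x : Gamma := projT1 (Gamma_choose h0 x).

Lemma Gamma_atE x : Gamma_at x h0 = x.
Proof. by rewrite /Gamma_at; case: Gamma_choose. Qed.

Lemma Gamma_atK (f : Gamma) : Gamma_at (f h0) = f.
Proof. by apply: (@Gamma_free _ _ h0); rewrite Gamma_atE. Qed.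

(* h0 alpha_x alpha_y, where alpha_x = [Gamma_at x] maps h0 to x. *)
Definition star x y : star_group h0 := (Gamma_at x * Gamma_at y) h0.
Definition star_inv x : star_group h0 := (Gamma_at x)^-1 h0.

Lemma starA : associative star.
Proof. by move=> x y z; rewrite /star !Gamma_atK mulgA. Qed.
Lemma star1x : left_id (h0 : star_group h0) star.
Proof. by move=> x; rewrite /star (Gamma_atK 1) mul1g Gamma_atE. Qed.
Lemma starx1 : right_id (h0 : star_group h0) star.
Proof. by move=> x; rewrite /star (Gamma_atK 1) mulg1 Gamma_atE. Qed.
Lemma starVx : left_inverse (h0 : star_group h0) star_inv star.
Proof. by move=> x; rewrite /star /star_inv Gamma_atK mulVg. Qed.
Lemma starxV : right_inverse (h0 : star_group h0) star_inv star.
Proof. by move=> x; rewrite /star /star_inv Gamma_atK mulgV. Qed.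

HB.instance Definition _ := isGroup.Build (star_group h0)
  starA star1x starx1 starVx starxV.

End Star.

End Schutzenberger.

(* If H is contained in L, this is the restriction of sigma to H. *)
Definition restrict_H (S : semigroupType) (L : Lclass S) (H : Hclass S)
    (sigma : Cong (Lbar L)) : set (H * H) :=
  [set p | (to_Lbar L (val p.1), to_Lbar L (val p.2)) \in val sigma].

Arguments restrict_H {S L} H sigma.

(* Main.v *)
Require Import Defs.
From mathcomp Require Import all_boot all_order.
From mathcomp Require Import boolp classical_sets.
From HB Require Import structures.
Local Open Scope classical_set_scope.

Set Implicit Arguments.
Unset Strict Implicit.
Unset Printing Implicit Defensive.

Import Order.Theory.

(** The point is that left translations of [H] by the semigroup and left
    translations of the group [(H, star)] are the same maps. Elements of the
    Schützenberger group act by right multiplications, which commute with left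
    multiplications by elements of [S^1]. So if [a = t h0], then [a * y], being
    the image of [a] under the group element that takes [h0] to [y], equals
    [t y] ([star_mull]); and any [t] that takes one element of [H] into [H]
    takes all of [H] into [H] ([Hclass_mull]). As [H] lies in an L-class, every
    [a] in [H] has the form [t h0]. Hence the restriction to [H] of a congruence
    of the act is a left congruence of [(H, star)] ([restrict_congruence]).

    Conversely, a left congruence [tau] extends to the relation that holds for
    two H-related points exactly when every [t] that carries both of them into
    [H] carries them to a pair of [tau] ([extension]). It restricts to [tau]
    because on [H] such a [t] is a left translation of the group
    ([extensionK]). And every congruence below the H-relation is the extension
    of its restriction ([restrictK]), because any [x] in [L] can be moved to
    [h0] and back by multiplication on the left, and these multiplications also
    move anything R-related to [x] there and back. Both constructions preserve
    inclusion, so they are mutually inverse lattice isomorphisms.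

    For the second part, a left congruence of a group is determined by the class
    of the identity, which is a subgroup, its classes being the left cosets
    ([LCong_Subgroups]); and [(H, star)] is isomorphic to the Schützenberger
    group by the map sending [x] to the group element taking [h0] to [x]. *)

(** * Lattice isomorphisms *)

(** Meets and joins are determined by the order, so monotone maps inverse to
    each other preserve them. *)
Lemma inverse_homo_lmorphism d d' (T : latticeType d) (T' : latticeType d')
    (f : T -> T') (g : T' -> T) :
    {homo f : x y / (x <= y)%O} -> {homo g : x y / (x <= y)%O} ->
    cancel f g -> cancel g f ->
  exists2 phi : {lmorphism T -> T'}, bijective phi & phi =1 f.
Proof.
move=> f_le g_le fK gK.
have fI : Order.meet_morphism f.
  move=> x y; apply/le_anti; rewrite lexI !f_le ?leIl ?leIr //=.
  by rewrite -[X in (X <= _)%O]gK f_le // lexI -{2}[x]fK -{3}[y]fK !g_le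
             ?leIl ?leIr.
have fU : Order.join_morphism f.
  move=> x y; apply/le_anti; rewrite leUx !f_le ?leUl ?leUr //= andbT.
  by rewrite -[X in (_ <= X)%O]gK f_le // leUx -{1}[x]fK -{2}[y]fK !g_le
             ?leUl ?leUr.
pose f_order := Order.isOrderMorphism.Build d T d' T' f f_le.
pose f_meet := Order.isMeetLatticeMorphism.Build d T d' T' f fI.
pose f_join := Order.isJoinLatticeMorphism.Build d T d' T' f fU.
pose phi : {lmorphism T -> T'} := HB.pack f f_order f_meet f_join.
by exists phi => //; exists g.
Qed.

Lemma lmorphism_bij_comp d d' d'' (T : latticeType d) (T' : latticeType d')
    (T'' : latticeType d'') (f : {lmorphism T -> T'}) (g : {lmorphism T' -> T''}) :
  bijective f -> bijective g -> exists h : {lmorphism T -> T''}, bijective h.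
Proof.
move=> f_bij g_bij.
pose h : {lmorphism T -> T''} := HB.pack (g \o f).
by exists h; exact: bij_comp.
Qed.

Definition Closed T (C : closure_system T) (A : set T) (AC : is_closed C A) :
  closed_set C := ClosedSet (mem_set AC).

Lemma closed_set_eq T (C : closure_system T) (X Y : closed_set C) :
  X = Y :> set T -> X = Y.
Proof. exact: val_inj. Qed.

(** * Left congruences of a group *)

Section LeftCongruencesOfGroup.
Variable G : groupType.
Local Open Scope group_scope.

Lemma class1_subgroup (tau : LCong G) :
  is_subgroup [set x : G | (tau : set (G * G)) (1, x)].
Proof.
have [tau_refl tau_sym tau_trans tau_mul] := closed_setP tau.
split=> [|x y /set_mem /= t1x /set_mem /= t1y]; apply/mem_set => /=.
  exact: tau_refl.
have t1yV : (tau : set (G * G)) (1, y^-1).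
  by apply: tau_sym; have := tau_mul y^-1 _ _ t1y; rewrite /= mulg1 mulVg.
by apply: tau_trans t1x _; have := tau_mul x _ _ t1yV; rewrite /= mulg1.
Qed.

Definition class1 (tau : LCong G) : Subgroups G :=
  @Closed _ (ClosureSystem (@is_subgroup_bigcap G)) _ (class1_subgroup tau).

Lemma coset_congruence (A : Subgroups G) :
  @is_congruence G (regular_act G)
    [set p : G * G | (A : set G) (p.1^-1 * p.2)].
Proof.
have Agrp := closed_setP A; have [A1 _] := Agrp.
have AV := group_closedV Agrp; have AM := group_closedM Agrp.
split=> [x|x y xy|x y z xy yz|s x y xy] /=; apply: set_mem.
- by rewrite mulVg.
- by rewrite -[X in _ * X]invgK -invgM; apply/AV/mem_set.
- by rewrite -[z](mulVKg y) mulgA; apply: AM; exact: mem_set.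
- by rewrite invgM -mulgA mulKg; exact: mem_set.
Qed.

Definition coset_cong (A : Subgroups G) : LCong G :=
  @Closed _ (cong_system (regular_act G)) _ (coset_congruence A).

(** Left translation by [x^-1] takes [(x, y)] to [(1, x^-1 y)] and translation by
    [x] takes it back: the class of the identity tells which pairs are
    congruent. *)
Lemma class1K : cancel class1 coset_cong.
Proof.
move=> tau; apply: closed_set_eq.
have [_ _ _ tau_mul] := closed_setP tau.
apply/seteqP; split=> -[x y] /= xy.
  by have := tau_mul x _ _ xy; rewrite /= mulg1 mulVKg.
by have := tau_mul x^-1 _ _ xy; rewrite /= mulVg.
Qed.

Lemma coset_congK : cancel coset_cong class1.
Proof.
by move=> A; apply: closed_set_eq; apply/seteqP; split=> x /=;
  rewrite invg1 mul1g.
Qed.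

Lemma LCong_Subgroups :
  exists psi : {lmorphism LCong G -> Subgroups G}, bijective psi.
Proof.
have [||phi phi_bij _] := inverse_homo_lmorphism _ _ class1K coset_congK.
- by move=> s t /closed_set_leP st; apply/closed_set_leP => x /st.
- by move=> A B /closed_set_leP AB; apply/closed_set_leP => x /AB.
- by exists phi.
Qed.

End LeftCongruencesOfGroup.

Lemma preimage_subgroup (G K : groupType) (f : G -> K) (A : Subgroups K) :
  {morph f : x y / (x * y)%g} -> is_subgroup (f @^-1` (A : set K)).
Proof.
move=> fM; have [A1 AD] := closed_setP A.
have f1 : f 1%g = 1%g by apply: (@mulgI K (f 1%g)); rewrite -fM !mulg1.
have fV x : f x^-1%g = (f x)^-1%g.
  by apply: (@mulgI K (f x)); rewrite -fM !mulgV.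
split=> [|x y /set_mem xA /set_mem yA]; apply/mem_set; rewrite /preimage /=.
  by rewrite f1; exact: set_mem.
by rewrite fM fV; apply/set_mem/AD; exact: mem_set.
Qed.

Lemma isomorphic_Subgroups (G K : groupType) (f : G -> K) (g : K -> G) :
    {morph f : x y / (x * y)%g} -> cancel f g -> cancel g f ->
  exists psi : {lmorphism Subgroups G -> Subgroups K}, bijective psi.
Proof.
move=> fM fK gK.
have gM : {morph g : x y / (x * y)%g}.
  by move=> x y; apply: (can_inj fK); rewrite fM !gK.
pose push (A : Subgroups G) : Subgroups K :=
  @Closed _ (ClosureSystem (@is_subgroup_bigcap K)) _ (preimage_subgroup A gM).
pose pull (B : Subgroups K) : Subgroups G :=
  @Closed _ (ClosureSystem (@is_subgroup_bigcap G)) _ (preimage_subgroup B fM).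
have [||||phi phi_bij _] := @inverse_homo_lmorphism _ _ _ _ push pull.
- by move=> A B /closed_set_leP AB; apply/closed_set_leP => x /AB.
- by move=> A B /closed_set_leP AB; apply/closed_set_leP => x /AB.
- by move=> A; apply: closed_set_eq; apply/seteqP; split=> x;
    rewrite /preimage /= fK.
- by move=> B; apply: closed_set_eq; apply/seteqP; split=> x;
    rewrite /preimage /= gK.
- by exists phi.
Qed.

Section Interval.
Variables (S : semigroupType) (L : Lclass S) (H : Hclass S).
Hypothesis HL : H `<=` L.
Local Open Scope group_scope.

(** * Left translations of an H-class *)

(** The element of the Schützenberger group taking [x] to [y] is a right
    multiplication, so it takes [t x] to [t y]; and it preserves [H]. *)
Lemma Hclass_mull (t : option S) (x x' y : H) :
  val x' = mulS1l t (val x) -> exists y' : H, val y' = mulS1l t (val y).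
Proof.
move=> x'E; have [f fx] := Gamma_transitive x y.
have [w _ fw] := set_mem (GammaP f).
by exists (f x'); rewrite fw x'E -mulS1lrA -fw fx.
Qed.

(** [a * y] is the image of [a = t h0] under the right multiplication that takes
    [h0] to [y], hence it is [t y]. *)
Lemma star_mull (h0 : H) (t : option S) (a y : star_group h0) :
  val (a : H) = mulS1l t (val h0) ->
  val (a * y : H) = mulS1l t (val (y : H)).
Proof.
move=> aE; have [w _ fw] := set_mem (GammaP (Gamma_at y)).
have -> : a * y = Gamma_at y a by rewrite -[in RHS](Gamma_atE a).
by rewrite fw aE -mulS1lrA -fw Gamma_atE.
Qed.

(** * The act on L with zero *)

(** The extension of the action to [S^1], with [None] in the role of the
    identity. *)
Definition act1 (t : option S) (a : Lbar L) : Lbar L :=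
  if t is Some s then act s a else a.

Lemma cong_act1 (sigma : Cong (Lbar L)) t a b :
  (sigma : set _) (a, b) -> (sigma : set _) (act1 t a, act1 t b).
Proof. by have [_ _ _ sA] := closed_setP sigma; case: t => //= s; apply: sA. Qed.

Lemma to_LbarE (x : L) : to_Lbar L (val x) = Some x.
Proof. exact: valK. Qed.

Definition to_L x (Lx : Lclass_set L x) : L :=
  exist (fun z => z \in (L : set S)) x (mem_set Lx).

Lemma act1_to_Lbar t x :
  Lclass_set L x -> act1 t (to_Lbar L x) = to_Lbar L (mulS1l t x).
Proof.
move=> Lx; case: t => [s|] //=; rewrite -[x]/(val (to_L Lx)).
by rewrite to_LbarE.
Qed.

Lemma to_Lbar_inj x y : Lclass_set L y -> to_Lbar L x = to_Lbar L y -> x = y.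
Proof.
move=> Ly; rewrite {2}/to_Lbar (insubT (fun z => z \in (L : set S)) (mem_set Ly)).
by rewrite /to_Lbar; case: insubP => //= u _ <- [->].
Qed.

Lemma H_in_L (x : H) : Lclass_set L (val x).
Proof. exact/HL/set_mem/(valP x). Qed.

Lemma HL_setH (x y : H) : HL_set (to_Lbar L (val x), to_Lbar L (val y)).
Proof.
left; exists (to_L (H_in_L x)), (to_L (H_in_L y)).
by split; [rewrite -!to_LbarE|exact: H_greenH].
Qed.

(** Congruences below [HL_set] cannot relate an element of [H] to a point outside
    [H], in particular not to zero. *)
Lemma HL_set_saturated (x : H) (b : Lbar L) :
  HL_set (to_Lbar L (val x), b) -> exists y : H, b = to_Lbar L (val y).
Proof.
case=> [[x' [y' [[xx' ->] x'y']]]|[]].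
  have x'E : val x' = val x by apply: to_Lbar_inj (H_in_L x) _; rewrite to_LbarE.
  have Hy : val y' \in (H : set S).
    apply/mem_set/(Hclass_greenH _ (set_mem (valP x))).
    by rewrite -x'E.
  by exists (exist (fun z => z \in (H : set S)) _ Hy); rewrite to_LbarE.
rewrite -[val x]/(val (to_L (H_in_L x))).
by rewrite to_LbarE.
Qed.

Section Star.
Variable h0 : H.

Lemma restrict_congruence (sigma : Cong (Lbar L)) :
  @is_congruence _ (regular_act (star_group h0)) (restrict_H H sigma).
Proof.
have [s_refl s_sym s_trans _] := closed_setP sigma.
split=> [x|x y|x y z|a x y]; rewrite /restrict_H /=.
- by apply/mem_set; exact: s_refl.
- by move=> /set_mem xy; apply/mem_set; exact: s_sym.
- by move=> /set_mem xy /set_mem yz; apply/mem_set; exact: s_trans yz.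
- move=> /set_mem xy; apply/mem_set.
  have [/greenLP [[t aE] _] _] := H_greenH h0 a.
  rewrite !(star_mull _ aE) -!act1_to_Lbar; try exact: H_in_L.
  exact: cong_act1.
Qed.

Definition restrict_LCong
    (sigma : lattice_interval (Delta_Lbar L) (H_Lbar L)) :
  LCong (star_group h0) :=
  @Closed _ (cong_system (regular_act (star_group h0))) _
    (restrict_congruence (val sigma)).

(** When [tau] is a left congruence of [(H, star)], this is the largest
    congruence below [HL_set] whose restriction to [H] is contained in [tau]:
    the condition on all [t] is what makes it stable under the action. *)
Definition extension (tau : set (H * H)) : set (Lbar L * Lbar L) :=
  [set p | HL_set p /\ forall t (x y : H),
     act1 t p.1 = to_Lbar L (val x) -> act1 t p.2 = to_Lbar L (val y) ->
     tau (x, y)].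

Lemma extension_congruence (tau : LCong (star_group h0)) :
  is_congruence (extension tau).
Proof.
have [t_refl t_sym t_trans _] := closed_setP tau.
have [H_refl H_sym H_trans H_act] := closed_setP (H_Lbar L).
split=> [a|a b [Hab tab]|a b c [Hab tab] [Hbc tbc]|s a b [Hab tab]].
- split=> [|t x y /= -> xy]; first exact: H_refl.
  by rewrite (val_inj (to_Lbar_inj (H_in_L y) xy)); exact: t_refl.
- by split=> [|t x y /= ax by_]; [exact: H_sym|apply/t_sym/(tab t)].
- split=> [|t x z /= ax cz]; first exact: H_trans Hbc.
  (* The middle point is carried into [H] too, being H-related to [a]. *)
  have [y by_] : exists y : H, act1 t b = to_Lbar L (val y).
    by apply: (@HL_set_saturated x); rewrite -ax; exact: (@cong_act1 (H_Lbar L)).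
  exact: t_trans (tab t x y ax by_) (tbc t y z by_ cz).
- split=> [|t x y /=]; first exact: H_act.
  case: t => [t|]; last exact: (tab (Some s)).
  by rewrite /= !Lbar_actA; exact: (tab (Some (t * s))).
Qed.

Definition extension_Cong (tau : LCong (star_group h0)) : Cong (Lbar L) :=
  @Closed _ (cong_system (Lbar L)) _ (extension_congruence tau).

Lemma extension_interval (tau : LCong (star_group h0)) :
  (Delta_Lbar L <= extension_Cong tau <= H_Lbar L)%O.
Proof.
have [e_refl _ _ _] := closed_setP (extension_Cong tau).
apply/andP; split; apply/closed_set_leP => -[a b].
  by rewrite /= /Delta_set /= => ->; exact: e_refl.
by case.
Qed.

Definition extension_in (tau : LCong (star_group h0)) :
  lattice_interval (Delta_Lbar L) (H_Lbar L) :=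
  LatticeInterval (extension_interval tau).

(** A left multiplication that carries [x] into [H] is on [H] the left
    translation by [t h0] of the group, which preserves [tau]. *)
Lemma extensionK : cancel extension_in restrict_LCong.
Proof.
move=> tau; apply: closed_set_eq; apply/seteqP; split=> -[x y].
  by move=> /set_mem [_ txy]; exact: (txy None).
move=> txy; apply/mem_set; split=> [|t x' y' /=]; first exact: HL_setH.
rewrite !act1_to_Lbar; try exact: H_in_L.
move=> /(to_Lbar_inj (H_in_L x'))/esym x'E /(to_Lbar_inj (H_in_L y'))/esym y'E.
have [a aE] := Hclass_mull h0 x'E.
have [_ _ _ /(_ (a : star_group h0) _ _ txy)] := closed_setP tau.
congr ((_ : set _) (_, _)); apply: val_inj.
- by rewrite x'E; exact: (star_mull (x : star_group h0) aE).
- by rewrite y'E; exact: (star_mull (y : star_group h0) aE).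
Qed.

(** If [t x = h0] and [u h0 = x], and [y] is H-related to [x], then
    [u t y = y] as [y] lies in [x S^1]. So [(x, y)] is recovered by acting with [u]
    on the pair [(t x, t y)] of elements of [H]. *)
Lemma restrictK : cancel restrict_LCong extension_in.
Proof.
move=> sigma; apply/val_inj/closed_set_eq/seteqP.
have /andP[_ /closed_set_leP sH] := interval_valP sigma.
have [s_refl _ _ _] := closed_setP (val sigma).
split=> [[a b]|[a b] sab].
  move=> [Hab]; case: (Hab) => [[x [y [[ax bx] xy]]]|[-> -> _]]; last first.
    by apply: s_refl.
  rewrite {a}ax {b}bx in Hab * => sab.
  have Lx := set_mem (valP x); have Ly := set_mem (valP y).
  have Lh := H_in_L h0.
  have [[t hE] [u xE]] := (greenLP _ _).1 ((Lclass_greenL _ Lx).1 Lh).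
  have tx : act1 t (Some x) = to_Lbar L (val h0).
    by rewrite -to_LbarE act1_to_Lbar // -hE.
  have [k ty] : exists k : H, act1 t (Some y) = to_Lbar L (val k).
    by apply: (@HL_set_saturated h0); rewrite -tx; exact: (@cong_act1 (H_Lbar L)).
  have /set_mem shk := sab t h0 k tx ty.
  have := cong_act1 u shk; rewrite !act1_to_Lbar; try exact: H_in_L.
  rewrite -xE; suff <- : val y = mulS1l u (val k) by rewrite !to_LbarE.
  have kE : val k = mulS1l t (val y).
    apply/esym/to_Lbar_inj; first exact: H_in_L.
    by rewrite -ty -to_LbarE act1_to_Lbar.
  have [_ /greenRP [[w yE] _]] := xy.
  by rewrite kE yE !mulS1lrA -hE -xE.
split=> [|t x y ax by_]; first exact: sH.
by apply/mem_set; rewrite /= -ax -by_; exact: cong_act1.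
Qed.

End Star.
End Interval.

Theorem proposition7p2 (S : semigroupType) (L : Lclass S) (H : Hclass S)
    (HL : H `<=` L) :
  (forall h0 : H,
    exists2 phi : {lmorphism lattice_interval (Delta_Lbar L) (H_Lbar L) ->
                             LCong (star_group h0)},
      bijective phi
      & forall sigma : lattice_interval (Delta_Lbar L) (H_Lbar L),
          phi sigma = restrict_H H (val sigma) :> set (H * H))
  /\ (exists psi : {lmorphism lattice_interval (Delta_Lbar L) (H_Lbar L) ->
                              Subgroups (Gamma H)},
       bijective psi).
Proof.
have restriction (h0 : H) :
    exists2 phi : {lmorphism lattice_interval (Delta_Lbar L) (H_Lbar L) ->
                             LCong (star_group h0)},
      bijective phi
      & forall sigma : lattice_interval (Delta_Lbar L) (H_Lbar L),
          phi sigma = restrict_H H (val sigma) :> set (H * H).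
  have [||phi phi_bij phiE] :=
      inverse_homo_lmorphism _ _ (restrictK HL h0) (@extensionK _ _ _ HL h0).
  - move=> s t /closed_set_leP st; apply/closed_set_leP => p /set_mem sp.
    exact/mem_set/st.
  - move=> s t /closed_set_leP st; apply/closed_set_leP => p [Hp sp].
    by split=> // u x y ux uy; apply/st/(sp u).
  - by exists phi => // sigma; rewrite phiE.
split=> //.
have [h0 Hh0] : exists h0, h0 \in (H : set S).
  by have [a Ha] := HclassP H; exists a; apply/mem_set; rewrite Ha.
pose h : H := exist (fun z => z \in (H : set S)) h0 Hh0.
have [phi phi_bij _] := restriction h.
have [psi psi_bij] := LCong_Subgroups (star_group h).
have [||chi chi_bij] := @isomorphic_Subgroups (star_group h) (Gamma H)
    (@Gamma_at _ _ h) (fun f : Gamma H => f h) _ (@Gamma_atE _ _ h).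
- by move=> x y; exact: Gamma_atK.
- exact: Gamma_atK.
have [xi xi_bij] := lmorphism_bij_comp phi_bij psi_bij.
exact: lmorphism_bij_comp xi_bij chi_bij.
Qed.
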